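(* Let $G$ be any $d$-regular graph and consider the random matching model. Then for any $K\ge\epsilon>0$, \[ \tau_{\operatorname{cont}}(K,\epsilon) \leq \frac{8}{d \cdot p_{\min}} \cdot \frac{1}{1-\lambda_2(\mathbf{P})}\cdot\log \left( \frac{K n^2}{\epsilon/2} \right). \]
   Context: $G=(V,E)$ is an undirected connected graph with $n$ nodes and maximum degree $\Delta$. A matching $\mathbf{M}^{(t)}\subseteq E$ is identified with the symmetric matrix with $\mathbf{M}^{(t)}_{u,u}=\mathbf{M}^{(t)}_{v,v}=\mathbf{M}^{(t)}_{u,v}=\mathbf{M}^{(t)}_{v,u}=1/2$ for $\{u,v\}\in\mathbf{M}^{(t)}$, $\mathbf{M}^{(t)}_{u,u}=1$ if $u$ is unmatched, other entries $0$. The continuous process is $\xi^{(t)}=\xi^{(t-1)}\mathbf{M}^{(t)}$ (row vectors). Random matching model: in each round a random matching is generated, independently across rounds, and $p_{\min}:=\min_t\min_{\{u,v\}\in E}\Pr[\{u,v\}\in\mathbf{M}^{(t)}]$, with $p_{\min}=\Omega(1/\Delta)$. The discrepancy of $\xi$ is $\max_{u,v}|\xi_u-\xi_v|$. For $t_1<t_2$, the interval $[t_1,t_2]$ (with its matchings $\mathbf{M}^{(t_1+1)},\dots,\mathbf{M}^{(t_2)}$) is $(K,\epsilon)$-smoothing if every $\xi^{(t_1)}\in\mathbb{R}^n$ with discrepancy at most $K$ yields $\xi^{(t_2)}$ with discrepancy at most $\epsilon$. In the random matching model, $\tau_{\operatorname{cont}}(K,\epsilon)$ is the minimum $t\in\mathbb{N}$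 such that $[0,t]$ is $(K,\epsilon)$-smoothing with probability at least $1-n^{-1}$ (over the random matchings). $\mathbf{P}$ is the matrix with $\mathbf{P}_{u,v}=\frac{1}{2\Delta}$ for $\{u,v\}\in E$, $\mathbf{P}_{u,u}=1-\frac{\deg(u)}{2\Delta}$, $0$ otherwise, and $\lambda_2(\mathbf{P})$ is its second largest eigenvalue. *)

(* Defs.v *)
From HB Require Import structures.
From mathcomp Require Import all_boot all_order all_algebra.
From mathcomp Require Import boolp reals exp.
Set Implicit Arguments. Unset Strict Implicit. Unset Printing Implicit Defensive.
Import Order.TTheory GRing.Theory Num.Theory.
Local Open Scope ring_scope.

Section Defs.
Variables (R : realType) (n : nat).

Definition simple_graph (e : rel 'I_n) := symmetric e /\ irreflexive e.
Definition graph_connected (e : rel 'I_n) := forall u v, connect e u v.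
Definition deg (e : rel 'I_n) (u : 'I_n) : nat := #|[set v | e u v]|.
Definition regular (e : rel 'I_n) (d : nat) := forall u, deg e u = d.

Notation mtype := {set {set 'I_n}}.
Definition is_matching (e : rel 'I_n) (M : mtype) : bool :=
  [forall A in M, [exists u, [exists v, e u v && (A == [set u; v])]]] &&
  [forall A in M, [forall B in M, (A != B) ==> [disjoint A & B]]].

Definition match_mx (M : mtype) : 'M[R]_n :=
  \matrix_(u, v)
    if u == v then (if [exists A in M, u \in A] then 1/2 else 1)
    else (if [set u; v] \in M then 1/2 else 0).

Definition proc_mx (t : nat) (ms : {ffun 'I_t -> mtype}) : 'M[R]_n :=
  foldr (fun M A => match_mx M *m A) 1%:M [seq ms i | i <- enum 'I_t].

Definition disc (x : 'rV[R]_n) : R :=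
  \big[Num.max/0]_(u < n) \big[Num.max/0]_(v < n) `|x 0 u - x 0 v|.

Definition smoothing (A : 'M[R]_n) (K eps : R) : Prop :=
  forall xi : 'rV[R]_n, disc xi <= K -> disc (xi *m A) <= eps.

(* Random matching model: mu t is the distribution of the matching of round t
   (t >= 1); rounds are independent. *)
Definition random_matching_model (e : rel 'I_n) (mu : nat -> {ffun mtype -> R}) :=
  forall t, (0 < t)%N ->
    [/\ forall M, 0 <= mu t M, \sum_(M : mtype) mu t M = 1
      & forall M, mu t M != 0 -> is_matching e M].

Definition edge_prob (mu : nat -> {ffun mtype -> R}) (t : nat) (u v : 'I_n) : R :=
  \sum_(M : mtype | [set u; v] \in M) mu t M.

Definition pmin_lower_bound (e : rel 'I_n) (mu : nat -> {ffun mtype -> R}) (p : R) :=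
  forall t, (0 < t)%N -> forall u v, e u v -> p <= edge_prob mu t u v.

Definition prob_smoothing (mu : nat -> {ffun mtype -> R}) (t : nat) (K eps : R) : R :=
  \sum_(ms : {ffun 'I_t -> mtype})
     (\prod_(i < t) mu i.+1 (ms i)) *
     (if `[< smoothing (proc_mx ms) K eps >] then 1 else 0).

Definition is_tau_cont (mu : nat -> {ffun mtype -> R}) (K eps : R) (t : nat) :=
  1 - n%:R^-1 <= prob_smoothing mu t K eps /\
  forall t', (t' < t)%N -> prob_smoothing mu t' K eps < 1 - n%:R^-1.

(* The matrix P, with Delta the maximum degree. *)
Definition Pmx (e : rel 'I_n) (Delta : nat) : 'M[R]_n :=
  \matrix_(u, v)
    if u == v then 1 - (deg e u)%:R / (2 * Delta%:R)
    else if e u v then (2 * Delta%:R)^-1 else 0.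

Definition lambda2 (s : seq R) : R := nth 0 (sort (fun x y => y <= x) s) 1.

End Defs.

(* Main.v *)
Require Import Defs.
From HB Require Import structures.
From mathcomp Require Import all_boot all_order all_algebra.
From mathcomp Require Import boolp reals sequences exp.
From mathcomp Require Import ring lra.
Import Order.TTheory GRing.Theory Num.Theory.
Local Open Scope ring_scope.

(* A matching matrix is an orthogonal projection (it averages over the orbits of
   an involution), so a round lowers the squared norm of a zero-sum load vector y
   by the Dirichlet form of that matrix. In expectation this is at least d * p
   times the Dirichlet form of P, hence at least gamma * |y|^2 with
   gamma = d * p * (1 - lambda2). Over t rounds the centred basis vectors thus
   shrink, in expected squared norm, by a factor exp (- gamma * t). By linearity
   they control the discrepancy for all initial loads simultaneously, and Markov's
   inequality turns the expectation bound into the probability bound. Since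
   gamma <= 1, the claimed bound is at least 1, so rounding it down costs at most
   a factor 2, which the constant 8 absorbs. *)

(** * Spectral theorem for real symmetric matrices *)

Lemma char_poly_conj (F : comNzRingType) (n : nat) (H H' A : 'M[F]_n) :
  H *m H' = 1%:M -> char_poly (H *m A *m H') = char_poly A.
Proof.
move=> HH; rewrite /char_poly.
have HHp : map_mx polyC H *m map_mx polyC H' = 1%:M by rewrite -map_mxM HH map_mx1.
have -> : char_poly_mx (H *m A *m H') =
    map_mx polyC H *m char_poly_mx A *m map_mx polyC H'.
  by rewrite /char_poly_mx mulmxBr mulmxBl !map_mxM scalar_mxC -(mulmxA 'X%:M) HHp mulmx1.
by rewrite !det_mulmx mulrAC -det_mulmx HHp det1 mul1r.
Qed.

Lemma sqnormE (F : comNzRingType) (n : nat) (v : 'rV[F]_n) :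
  (v *m v^T) 0 0 = \sum_i v 0 i ^+ 2.
Proof. by rewrite !mxE; apply: eq_bigr => i _; rewrite !mxE expr2. Qed.

Lemma sqnorm_ge0 (F : realDomainType) (n : nat) (v : 'rV[F]_n) : 0 <= (v *m v^T) 0 0.
Proof. by rewrite sqnormE sumr_ge0 // => i _; rewrite sqr_ge0. Qed.

Lemma sqnorm_eq0 (F : realDomainType) (n : nat) (v : 'rV[F]_n) :
  ((v *m v^T) 0 0 == 0) = (v == 0).
Proof.
apply/idP/eqP => [|->]; last by rewrite mul0mx mxE.
rewrite sqnormE psumr_eq0 => [/allP h|i _]; last exact: sqr_ge0.
apply/rowP => i; rewrite mxE; apply/eqP.
by have := h i (mem_index_enum _); rewrite sqrf_eq0.
Qed.

(** The witness is the reflection in the hyperplane orthogonal to [w = v - e1], which swaps the unit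
    vectors [e1] and [v]. The dimension is written [1 + m] so that block matrices can split off the
    first axis. *)
Lemma householder (F : realFieldType) (m : nat) (v : 'rV[F]_(1 + m)) :
  v *m v^T = 1%:M ->
  exists H : 'M[F]_(1 + m),
    [/\ H^T = H, H *m H = 1%:M & delta_mx 0 0 *m H = v].
Proof.
move=> v1; pose e1 : 'rV[F]_(1 + m) := delta_mx 0 0; pose w := v - e1.
have e11 : e1 *m e1^T = 1%:M.
  by rewrite trmx_delta mul_delta_mx; apply/matrixP => i j; rewrite !ord1 !mxE.
(* For [v = e1] there is no hyperplane to reflect in, and the identity serves. *)
have [/eqP w0|wN0] := eqVneq w 0.
  exists 1%:M; split; rewrite ?trmx1 ?mulmx1 //.
  by move: w0; rewrite subr_eq0 => /eqP.
pose c := (w *m w^T) 0 0.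
have cN0 : c != 0 by rewrite sqnorm_eq0.
have wwE : w *m w^T = c%:M by rewrite [LHS]mx11_scalar.
pose a := (e1 *m v^T) 0 0.
have evE : e1 *m v^T = a%:M by rewrite [LHS]mx11_scalar.
have veE : v *m e1^T = a%:M.
  by rewrite -[LHS]trmxK trmx_mul trmxK evE tr_scalar_mx.
(* Here [v] and [e1] having equal length enters: it makes the coefficient of [w] in the image of
   [e1] equal to 1. *)
have cE : c = 2 * (1 - a).
  rewrite /c /w linearB /= mulmxBl !mulmxBr v1 veE evE e11 !mxE eqxx ?mulr1n; ring.
have ewE : e1 *m w^T = (a - 1)%:M.
  by rewrite /w linearB /= mulmxBr evE e11 -raddfB.
exists (1%:M - (2 / c) *: (w^T *m w)); split.
- by rewrite linearB /= linearZ /= trmx1 trmx_mul trmxK.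
- have : (w^T *m w) *m (w^T *m w) = c *: (w^T *m w).
    by rewrite mulmxA -(mulmxA w^T) wwE mul_mx_scalar -scalemxAl.
  move: (w^T *m w) => G GG.
  rewrite mulmxBl !mulmxBr !mul1mx mulmx1 -!scalemxAl -!scalemxAr GG !scalerA.
  rewrite (_ : 2 / c * (2 / c) * c = 2 / c + 2 / c); last by field.
  by rewrite scalerDl opprB addrK subrK.
- rewrite mulmxBr mulmx1 -scalemxAr mulmxA ewE mul_scalar_mx scalerA.
  have -> : 2 / c * (a - 1) = -1.
    by rewrite (_ : a - 1 = - (c / 2)); [field|rewrite cE; field].
  by rewrite scaleN1r opprK /w addrC subrK.
Qed.

(* Deflation: reflecting an eigenvector onto the first axis splits off one root. *)
Lemma symmetric_diagonalization (F : rcfType) (n : nat) (A : 'M[F]_n) (s : seq F) :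
  A^T = A -> char_poly A = \prod_(x <- s) ('X - x%:P) ->
  exists Q : 'M[F]_n,
    Q *m Q^T = 1%:M /\ Q *m A = diag_mx (\row_i s`_i) *m Q.
Proof.
elim: n A s => [|m IH] A s symA cA.
  by exists 1%:M; split; apply/matrixP => -[].
have size_s : size s = m.+1.
  by apply: succn_inj; rewrite -(size_prod_XsubC s id) -cA size_char_poly.
case: s cA size_s => // x s cA [size_s].
have : eigenvalue A x.
  by rewrite eigenvalue_root_char cA root_prod_XsubC mem_head.
case/eigenvalueP => v0 v0A v0N0.
pose r := (v0 *m v0^T) 0 0.
have r_gt0 : 0 < r by rewrite lt0r sqnorm_eq0 v0N0 sqnorm_ge0.
pose v : 'rV[F]_(1 + m) := (Num.sqrt r)^-1 *: v0.
have vv : v *m v^T = 1%:M.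
  rewrite /v linearZ /= -scalemxAl -scalemxAr scalerA.
  rewrite [v0 *m _]mx11_scalar -/r scale_scalar_mx -expr2 exprVn sqr_sqrtr ?ltW //.
  by rewrite mulVf // gt_eqF.
have vA : v *m A = x *: v by rewrite -scalemxAl v0A !scalerA mulrC.
have [H [symH HH eH]] := householder _ _ _ vv.
have [B defB] : exists B : 'M[F]_(1 + m), B = H *m A *m H by eexists.
have symB : B^T = B by rewrite defB !trmx_mul symA symH mulmxA.
have eB : delta_mx 0 0 *m B = x *: delta_mx 0 0 :> 'rV[F]_(1 + m).
  by rewrite defB !mulmxA eH vA -scalemxAl -eH -mulmxA HH mulmx1.
have B0 j : B 0 j = x * (j == 0)%:R.
  have := congr1 (fun M : 'rV[F]_(1 + m) => M 0 j) eB.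
  by rewrite -rowE !mxE eqxx.
pose B' := drsubmx B.
(* The first row vanishes off the diagonal because [e1] is an eigenvector of [B]; the first column
   follows by symmetry. *)
have BE : B = block_mx x%:M 0 0 B'.
  rewrite -[LHS]submxK; congr block_mx; apply/matrixP => i j; rewrite ?ord1 !mxE.
  - by rewrite !lshift0 B0 eqxx mulr1.
  - by rewrite lshift0 B0 mulr0.
  - by rewrite -symB mxE lshift0 B0 mulr0.
have symB' : B'^T = B' by rewrite trmx_drsub symB.
have cB' : char_poly B' = \prod_(y <- s) ('X - y%:P).
  (* Conjugation keeps the characteristic polynomial, so the root [x] can be cancelled from both
     sides in a domain. *)
  apply: (@mulfI _ ('X - x%:P)); first by rewrite polyXsubC_eq0.
  rewrite big_cons in cA; rewrite -cA -(char_poly_conj _ _ _ _ A HH) -defB BE.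
  pose x1 : 'M[F]_1 := x%:M.
  have -> : 'X - x%:P = \det (char_poly_mx x1).
    by rewrite det_mx11 !mxE eqxx !mulr1n.
  rewrite /char_poly (char_block_diag_mx x1 B').
  exact: (esym (det_ublock (char_poly_mx x1) 0 (char_poly_mx B'))).
have [Q' [QQ' QB']] := IH B' s symB' cB'.
pose Q1 : 'M[F]_(1 + m) := block_mx 1%:M 0 0 Q'.
have QQ : Q1 *m Q1^T = 1%:M.
  rewrite /Q1 tr_block_mx mulmx_block !trmx0 trmx1.
  by rewrite !(mulmx0, mul0mx, addr0, add0r, mulmx1) QQ' -scalar_mx_block.
pose D : 'M[F]_(1 + m) := block_mx x%:M 0 0 (diag_mx (\row_i s`_i)).
have QB : Q1 *m B = D *m Q1.
  rewrite BE /Q1 /D !mulmx_block.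
  by rewrite !(mulmx0, mul0mx, addr0, add0r, mulmx1, mul1mx) QB'.
have DE : D = diag_mx (\row_i (x :: s)`_i).
  have -> : \row_i (x :: s)`_i = row_mx x%:M (\row_i s`_i) :> 'rV[F]_(1 + m).
    apply/rowP => j; rewrite !mxE; case: splitP => k ->; rewrite !mxE //=.
    by rewrite !ord1.
  rewrite diag_mx_row /D; congr block_mx; apply/matrixP => i j.
  by rewrite !ord1 !mxE eqxx.
have HA : H *m A = B *m H by rewrite defB -!mulmxA HH mulmx1.
exists (Q1 *m H); split; last by rewrite -mulmxA HA !mulmxA QB DE.
by rewrite trmx_mul symH mulmxA -(mulmxA Q1) HH mulmx1.
Qed.

(** * Dirichlet forms and the matrix P of a regular graph *)

(** Rows, and by symmetry columns, sum to 1, so the squared norm of [y] is the [W]-weighted sum of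
    either [y 0 u ^+ 2] or [y 0 v ^+ 2]; then expand the square. Serving both P and the matching
    matrices, this reduces their comparison to off-diagonal entries. *)
Lemma dirichlet_form (F : realFieldType) (n : nat) (W : 'M[F]_n) (y : 'rV[F]_n) :
  W^T = W -> (forall u, \sum_v W u v = 1) ->
  (y *m y^T) 0 0 - (y *m W *m y^T) 0 0 =
  2^-1 * \sum_u \sum_v W u v * (y 0 u - y 0 v) ^+ 2.
Proof.
move=> symW sumW.
have yWy : (y *m W *m y^T) 0 0 = \sum_u \sum_v W u v * (y 0 u * y 0 v).
  rewrite mxE exchange_big; apply: eq_bigr => j _; rewrite !mxE mulr_suml.
  by apply: eq_bigr => i _; ring.
have yy1 : (y *m y^T) 0 0 = \sum_u \sum_v W u v * y 0 u ^+ 2.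
  rewrite sqnormE; apply: eq_bigr => u _.
  by rewrite -mulr_suml sumW mul1r.
have yy2 : (y *m y^T) 0 0 = \sum_u \sum_v W u v * y 0 v ^+ 2.
  rewrite yy1 exchange_big; apply: eq_bigr => u _; apply: eq_bigr => v _.
  by rewrite -[W in LHS]symW mxE.
have -> : \sum_u \sum_v W u v * (y 0 u - y 0 v) ^+ 2 =
    (y *m y^T) 0 0 + (y *m y^T) 0 0 - 2 * (y *m W *m y^T) 0 0.
  rewrite {1}yy1 yy2 yWy mulr_sumr -big_split -sumrB /=; apply: eq_bigr => u _.
  rewrite mulr_sumr -big_split -sumrB /=; apply: eq_bigr => v _.
  ring.
by field.
Qed.

Lemma connected_edge_constant (n : nat) (e : rel 'I_n) (T : Type) (f : 'I_n -> T) :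
  graph_connected e -> (forall u v, e u v -> f u = f v) ->
  forall u v, f u = f v.
Proof.
move=> conn fe u v; have /connectP[q eq ->] := conn u v.
elim: q u eq => //= w q IH u /andP[euw eq].
by rewrite (fe _ _ euw) IH.
Qed.

(** Without edges the identity map is vacuously constant along edges, hence constant by
    connectedness. *)
Lemma connected_regular_degree_gt0 (n d : nat) (e : rel 'I_n) :
  (1 < n)%N -> graph_connected e -> regular e d -> (0 < d)%N.
Proof.
move=> n1 conn reg; rewrite lt0n; apply/eqP => d0.
have noedge u v : e u v -> u = v.
  move=> euv; have := reg u; rewrite d0 => /eqP; rewrite cards_eq0 => /eqP/setP.
  by move=> /(_ v); rewrite !inE euv.
have := connected_edge_constant _ _ _ id conn noedge.
by move=> /(_ (Ordinal (ltnW n1)) (Ordinal n1)) /(congr1 val).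
Qed.

Lemma Pmx_sym (R : realType) (n d : nat) (e : rel 'I_n) :
  simple_graph e -> regular e d -> (Pmx R e d)^T = Pmx R e d.
Proof.
move=> [symE _] reg; apply/matrixP => u v; rewrite !mxE eq_sym symE !reg.
by case: eqP => // ->.
Qed.

Lemma sum_degree (F : nzRingType) (n : nat) (e : rel 'I_n) (u : 'I_n) (c : F) :
  \sum_v (if e u v then c else 0) = (deg e u)%:R * c.
Proof.
by rewrite -big_mkcond /= sumr_const mulr_natl /deg cardsE.
Qed.

Lemma Pmx_row_sum (R : realType) (n d : nat) (e : rel 'I_n) (u : 'I_n) :
  simple_graph e -> \sum_v Pmx R e d u v = 1.
Proof.
move=> [_ irrE]; rewrite (bigD1 u) //= mxE eqxx.
rewrite (eq_bigr (fun v => if e u v then (2 * d%:R)^-1 else 0)); last first.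
  by move=> v /negbTE; rewrite mxE eq_sym => ->.
have := sum_degree R _ e u (2 * d%:R)^-1.
by rewrite (bigD1 u) //= irrE add0r => ->; rewrite subrK.
Qed.

(** * Spectral gap of P on zero-sum vectors *)

Section SpectralGap.

Variables (R : realType) (n d : nat) (e : rel 'I_n) (s : seq R).
Hypotheses (n1 : (1 < n)%N) (graphE : simple_graph e).
Hypotheses (conn : graph_connected e) (reg : regular e d).
Hypothesis char_s : char_poly (Pmx R e d) = \prod_(x <- s) ('X - x%:P).

Let P := Pmx R e d.

Lemma Pmx_edge_ge0 (y : 'rV[R]_n) (u v : 'I_n) : 0 <= P u v * (y 0 u - y 0 v) ^+ 2.
Proof.
have [->|uv] := eqVneq u v; first by rewrite subrr expr0n mulr0.
rewrite mulr_ge0 ?sqr_ge0 // mxE (negbTE uv).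
by case: (e u v); rewrite // invr_ge0 mulr_ge0 ?ler0n.
Qed.

Lemma Pmx_dirichlet (y : 'rV[R]_n) :
  (y *m y^T) 0 0 - (y *m P *m y^T) 0 0 =
  2^-1 * \sum_u \sum_v P u v * (y 0 u - y 0 v) ^+ 2.
Proof.
apply: dirichlet_form; first exact: Pmx_sym.
by move=> u; apply: Pmx_row_sum.
Qed.

Lemma Pmx_rayleigh (y : 'rV[R]_n) : (y *m P *m y^T) 0 0 <= (y *m y^T) 0 0.
Proof.
rewrite -subr_ge0 Pmx_dirichlet mulr_ge0 ?invr_ge0 ?ler0n //.
by rewrite sumr_ge0 // => u _; rewrite sumr_ge0 // => v _; apply: Pmx_edge_ge0.
Qed.

(** A fixed vector has zero Dirichlet form, a sum of nonnegative terms, so every edge term vanishes.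
    This makes the eigenvalue 1 simple. *)
Lemma Pmx_fixed_constant (y : 'rV[R]_n) : y *m P = y ->
  forall u v, y 0 u = y 0 v.
Proof.
move=> yP; apply: (connected_edge_constant _ e) => // u v euv.
have := Pmx_dirichlet y; rewrite yP subrr => /esym/eqP.
rewrite mulf_eq0 invr_eq0 pnatr_eq0 /= psumr_eq0 => [/allP h|i _]; last first.
  by rewrite sumr_ge0 // => j _; apply: Pmx_edge_ge0.
have := h u (mem_index_enum _) => /=.
rewrite psumr_eq0 => [/allP {}h|i _]; last exact: Pmx_edge_ge0.
have := h v (mem_index_enum _) => /=.
have dN0 := connected_regular_degree_gt0 _ _ _ n1 conn reg.
have uv : u != v.
  by apply/eqP => uv; move: euv; rewrite uv graphE.2.
rewrite mulf_eq0 sqrf_eq0 mxE (negbTE uv) euv invr_eq0 mulf_eq0 !pnatr_eq0.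
by rewrite (gtn_eqF dN0) /= subr_eq0 => /eqP.
Qed.

(** In an orthonormal eigenbasis the top vector is constant, so a zero-sum [y] has no component
    along it, and every other eigenvalue is at most [lambda2 s]. *)
Lemma spectral_gap :
  0 < 1 - lambda2 s /\
  forall y : 'rV[R]_n, \sum_i y 0 i = 0 ->
    (1 - lambda2 s) * (y *m y^T) 0 0 <= (y *m y^T) 0 0 - (y *m P *m y^T) 0 0.
Proof.
pose sg := sort (fun x y : R => y <= x) s.
have char_sg : char_poly P = \prod_(x <- sg) ('X - x%:P).
  by rewrite /P char_s; apply: perm_big; rewrite perm_sym perm_sort.
have size_sg : size sg = n.
  by apply: succn_inj; rewrite -(size_prod_XsubC sg id) -char_sg size_char_poly.
have ge_tr : transitive (fun x y : R => y <= x).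
  by move=> x y z yx zx; apply: le_trans zx yx.
have sg_sorted : sorted (fun x y : R => y <= x) sg.
  by apply: sort_sorted => x y; apply: le_total.
have sg_le i j : (i <= j)%N -> (j < n)%N -> sg`_j <= sg`_i.
  move=> ij jn; apply: (sorted_leq_nth ge_tr) => //.
  - by rewrite inE size_sg (leq_ltn_trans ij).
  - by rewrite inE size_sg.
(* Diagonalization respects the order of the given list: with the sorted list, row [i] of [Q]
   belongs to the eigenvalue of rank [i], counted from 0. *)
have [Q [QQ QP]] := symmetric_diagonalization _ _ _ _ (Pmx_sym R n d e graphE reg) char_sg.
have QtQ : Q^T *m Q = 1%:M by apply: mulmx1C.
have rowQP i : row i Q *m P = sg`_i *: row i Q.
  by rewrite -row_mul QP; apply/rowP => j; rewrite mul_diag_mx !mxE.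
have rowQ i j : (row i Q *m (row j Q)^T) 0 0 = (i == j)%:R.
  have := congr1 (fun M : 'M[R]_n => M i j) QQ; rewrite !mxE => <-.
  by apply: eq_bigr => k _; rewrite !mxE.
have sg_le1 (i : 'I_n) : sg`_i <= 1.
  have := Pmx_rayleigh (row i Q).
  by rewrite rowQP -scalemxAl mxE rowQ eqxx mulr1.
pose i0 : 'I_n := Ordinal (ltnW n1); pose i1 : 'I_n := Ordinal n1.
have n_neq0 : n%:R != 0 :> R by rewrite pnatr_eq0 -lt0n ltnW.
(* The constant vector shows that 1 occurs somewhere in the list; the head is at least that, and at
   most 1. *)
have sg0 : sg`_i0 = 1.
  apply/eqP; rewrite eq_le sg_le1 /=.
  have : eigenvalue P 1.
    apply/eigenvalueP; exists (const_mx 1); last first.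
      by apply/eqP => /rowP/(_ i0)/eqP; rewrite !mxE oner_eq0.
    apply/rowP => u; rewrite scale1r mxE [RHS]mxE -[RHS](Pmx_row_sum R n d e u graphE).
    apply: eq_bigr => v _; rewrite [const_mx _ _ _]mxE mul1r.
    by rewrite -[in RHS](Pmx_sym R n d e graphE reg) [RHS]mxE.
  rewrite eigenvalue_root_char char_sg root_prod_XsubC => /(nthP 0)[k].
  by rewrite size_sg => kn <-; apply: sg_le.
have fixed_row (i : 'I_n) : sg`_i = 1 -> exists2 c, c != 0 & forall u, Q i u = c.
  move=> sgi; have fixi : row i Q *m P = row i Q by rewrite rowQP sgi scale1r.
  have cst u : Q i u = Q i i0.
    by have := Pmx_fixed_constant _ fixi u i0; rewrite !mxE.
  exists (Q i i0) => //; apply/eqP => Q0; have := rowQ i i; rewrite sqnormE.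
  rewrite big1 => [|u _]; last by rewrite mxE cst Q0 expr0n.
  by rewrite eqxx => /esym/eqP; rewrite oner_eq0.
have [c cN0 Qc] := fixed_row i0 sg0.
have l2E : lambda2 s = sg`_i1 by [].
split.
  (* If the second eigenvalue were 1, rows 0 and 1 of [Q] would both be nonzero constants, with
     inner product [n * c * c'] instead of 0. *)
  rewrite subr_gt0 l2E lt_neqAle sg_le1 andbT; apply/eqP => sg1.
  have [c' c'N0 Qc'] := fixed_row i1 sg1.
  have := rowQ i0 i1; rewrite mxE (_ : (i0 == i1) = false) //.
  under eq_bigr do rewrite !mxE Qc Qc'.
  rewrite sumr_const card_ord -[_ *+ n]mulr_natl => /eqP.
  by rewrite !mulf_eq0 (negbTE n_neq0) (negbTE cN0) (negbTE c'N0).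
(* [z] holds the coordinates of [y] in the eigenbasis. *)
move=> y sum_y; pose z := y *m Q^T.
have yE : y = z *m Q by rewrite -mulmxA QtQ mulmx1.
have z0 : z 0 i0 = 0.
  rewrite mxE; under eq_bigr do rewrite mxE Qc.
  by rewrite -mulr_suml sum_y mul0r.
have yy : (y *m y^T) 0 0 = (z *m z^T) 0 0.
  by rewrite {1 2}yE trmx_mul mulmxA -(mulmxA z) QQ mulmx1.
have yPy : (y *m P *m y^T) 0 0 = \sum_(i < n) sg`_i * z 0 i ^+ 2.
  rewrite {1 2}yE trmx_mul -(mulmxA z) QP !mulmxA -(mulmxA _ Q) QQ mulmx1.
  rewrite mxE; apply: eq_bigr => i _.
  by rewrite mul_mx_diag !mxE expr2; ring.
suff : (y *m P *m y^T) 0 0 <= lambda2 s * (y *m y^T) 0 0 by lra.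
rewrite yPy yy sqnormE mulr_sumr ler_sum // => i _.
have [->|iN0] := eqVneq i i0; first by rewrite z0 expr0n !mulr0.
apply: ler_wpM2r; first exact: sqr_ge0.
by rewrite l2E; apply: sg_le; rewrite // lt0n.
Qed.

End SpectralGap.

(** * Matching matrices as averages over an involution *)

Section Matching.

Variables (R : realType) (n : nat) (e : rel 'I_n) (M : {set {set 'I_n}}).
Hypotheses (graphE : simple_graph e) (matchM : is_matching e M).

(** Encodes the matching as an involution whose fixed points are the unmatched nodes, so that
    matched and unmatched nodes obey one averaging formula. *)
Definition partner (u : 'I_n) : 'I_n :=
  if [pick v | (v != u) && ([set u; v] \in M)] is Some v then v else u.

Lemma partner_eq (u v : 'I_n) : v != u -> [set u; v] \in M -> partner u = v.
Proof.
move=> vu uvM; rewrite /partner; case: pickP => [w /andP[wu uwM]|/(_ v)]; last first.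
  by rewrite vu uvM.
have /andP[_ /'forall_implyP/(_ _ uwM)/'forall_implyP/(_ _ uvM)] := matchM.
(* Two matching edges through [u] are not disjoint, hence they are equal. *)
have [uwv _|_ /= /pred0P/(_ u)] := eqVneq [set u; w] [set u; v].
  by have := set22 u w; rewrite uwv !inE (negbTE wu) => /eqP.
by rewrite !inE eqxx.
Qed.

Lemma partner_neq (u : 'I_n) : partner u != u -> [set u; partner u] \in M.
Proof. by rewrite /partner; case: pickP => [v /andP[]|]; rewrite ?eqxx. Qed.

Lemma partnerK : involutive partner.
Proof.
move=> u; have [pu|pu] := eqVneq (partner u) u; first by rewrite !pu.
by apply: partner_eq; rewrite 1?eq_sym // setUC partner_neq.
Qed.

Lemma partner_neqE (u : 'I_n) : (partner u != u) = [exists A in M, u \in A].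
Proof.
apply/idP/'exists_andP => [pu|[A [AM uA]]].
  by exists [set u; partner u]; rewrite partner_neq // !inE eqxx.
have /andP[/'forall_implyP/(_ _ AM)/existsP[a /existsP[b /andP[eab /eqP AE]]] _] := matchM.
have ab : b != a by apply/eqP => ab; move: eab; rewrite ab graphE.2.
move: AM uA; rewrite AE => abM; rewrite !inE => /orP[] /eqP ->.
  by rewrite (partner_eq _ _ ab abM).
rewrite setUC in abM; rewrite (partner_eq _ a) // eq_sym //.
Qed.

(** The matrix is half the sum of the identity and the permutation matrix of [partner]; at an
    unmatched node both indicators hit the diagonal and give 1. *)
Lemma match_mxE (u v : 'I_n) :
  match_mx R M u v = ((v == u)%:R + (v == partner u)%:R) / 2.
Proof.
rewrite mxE; have [->|uv] := eqVneq u v.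
  rewrite -partner_neqE (eq_sym v); case: eqVneq => _ /=; last by rewrite addr0.
  by field.
rewrite add0r (_ : ([set u; v] \in M) = (v == partner u)); last first.
  apply/idP/eqP => [uvM|vE]; first by rewrite (partner_eq _ v) // eq_sym.
  by rewrite vE partner_neq // -vE eq_sym.
by case: eqP => _ //=; rewrite mul0r.
Qed.

Lemma match_mx_sym : (match_mx R M)^T = match_mx R M.
Proof. by apply/matrixP => u v; rewrite !mxE eq_sym setUC; case: eqP => // ->. Qed.

Lemma mul_match_mx (y : 'rV[R]_n) (u : 'I_n) :
  (y *m match_mx R M) 0 u = (y 0 u + y 0 (partner u)) / 2.
Proof.
rewrite mxE (eq_bigr (fun v => ((if v == u then y 0 v else 0) +
    (if v == partner u then y 0 v else 0)) / 2)); last first.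
  move=> v _; rewrite -match_mx_sym mxE match_mxE.
  by do 2!case: eqP => _ /=; rewrite ?addr0 ?add0r ?mul0r ?mulr0 //; field.
by rewrite -mulr_suml big_split /= -!big_mkcond !big_pred1_eq.
Qed.

Lemma match_mx_row_sum (u : 'I_n) : \sum_v match_mx R M u v = 1.
Proof.
transitivity ((const_mx 1 *m match_mx R M : 'rV_n) 0 u).
  rewrite mxE; apply: eq_bigr => v _.
  by rewrite -[in LHS]match_mx_sym mxE [const_mx _ _ _]mxE mul1r.
by rewrite mul_match_mx !mxE; field.
Qed.

(** This is idempotence of a symmetric matrix, in quadratic form: reindexing by [partner] preserves
    the sum of squares. *)
Lemma match_mx_sqnorm (y : 'rV[R]_n) :
  ((y *m match_mx R M) *m (y *m match_mx R M)^T) 0 0 =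
  (y *m match_mx R M *m y^T) 0 0.
Proof.
rewrite sqnormE mxE.
have S : \sum_u y 0 (partner u) ^+ 2 = \sum_u y 0 u ^+ 2.
  by rewrite [RHS](reindex_inj (inv_inj partnerK)).
rewrite (eq_bigr (fun u => 4^-1 * (y 0 u ^+ 2 + y 0 (partner u) ^+ 2) +
   2^-1 * (y 0 u * y 0 (partner u)))); last by move=> u _; rewrite mul_match_mx; field.
rewrite big_split /= -mulr_sumr big_split /= S.
rewrite [RHS](eq_bigr (fun u => 2^-1 * y 0 u ^+ 2 +
   2^-1 * (y 0 u * y 0 (partner u)))); last first.
  by move=> u _; rewrite mul_match_mx mxE; field.
by rewrite big_split /= -[in RHS]mulr_sumr; congr (_ + _); field.
Qed.

Lemma match_mx_sum (y : 'rV[R]_n) :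
  \sum_u (y *m match_mx R M) 0 u = \sum_u y 0 u.
Proof.
under eq_bigr do rewrite mxE.
rewrite exchange_big; apply: eq_bigr => u _.
by rewrite -mulr_sumr match_mx_row_sum mulr1.
Qed.

End Matching.

(** * Expected contraction in one round *)

Section OneRound.

Variables (R : realType) (n d : nat) (e : rel 'I_n) (s : seq R).
Notation mtype := {set {set 'I_n}}.
Variables (nu : {ffun mtype -> R}) (p : R).
Hypotheses (n1 : (1 < n)%N) (graphE : simple_graph e).
Hypotheses (conn : graph_connected e) (reg : regular e d).
Hypothesis char_s : char_poly (Pmx R e d) = \prod_(x <- s) ('X - x%:P).
Hypothesis nu_ge0 : forall M : mtype, 0 <= nu M.
Hypothesis nu_sum : \sum_(M : mtype) nu M = 1.
Hypothesis nu_matching : forall M : mtype, nu M != 0 -> is_matching e M.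
Hypothesis p_ge0 : 0 <= p.
Hypothesis p_le : forall u v, e u v -> p <= \sum_(M : mtype | [set u; v] \in M) nu M.

(** On an edge the left side is [p / 2] and the right side is half the edge probability; on a
    non-edge the left side is 0. *)
Lemma expected_match_entry (u v : 'I_n) : u != v ->
  p * d%:R * Pmx R e d u v <= \sum_(M : mtype) nu M * match_mx R M u v.
Proof.
move=> uv; rewrite mxE (negbTE uv).
under eq_bigr do rewrite mxE (negbTE uv).
have dN0 : d%:R != 0 :> R.
  by rewrite pnatr_eq0 -lt0n (connected_regular_degree_gt0 _ _ _ n1 conn reg).
case: ifP => [euv|_]; last first.
  by rewrite mulr0 sumr_ge0 // => M _; rewrite mulr_ge0 //; case: ifP; rewrite ?divr_ge0.
rewrite (eq_bigr (fun M : mtype =>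
  (if [set u; v] \in M then nu M else 0) / 2)); last first.
  by move=> M _; case: ifP => _; rewrite ?mul1r ?mulr0 ?mul0r.
rewrite -mulr_suml -big_mkcond /=.
rewrite (_ : p * _ * _ = p / 2); last by field.
by apply: ler_wpM2r; [rewrite invr_ge0|apply: p_le].
Qed.

(** The Dirichlet form is linear in the matrix, so the expected loss is the form of the expected
    matching matrix. Comparing entries bounds it below by [d * p] times the form of P, and the
    spectral gap finishes. *)
Lemma round_contraction (y : 'rV[R]_n) : \sum_i y 0 i = 0 ->
  \sum_(M : mtype) nu M * ((y *m match_mx R M) *m (y *m match_mx R M)^T) 0 0
  <= (1 - d%:R * p * (1 - lambda2 s)) * (y *m y^T) 0 0.
Proof.
move=> sum_y; set N := (y *m y^T) 0 0.
have -> : \sum_(M : mtype) nu M * ((y *m match_mx R M) *m (y *m match_mx R M)^T) 0 0 =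
    N - 2^-1 * \sum_u \sum_v
      (\sum_(M : mtype) nu M * match_mx R M u v) * (y 0 u - y 0 v) ^+ 2.
  transitivity (\sum_(M : mtype) (nu M * N - 2^-1 *
      \sum_u \sum_v (nu M * match_mx R M u v) * (y 0 u - y 0 v) ^+ 2)).
    apply: eq_bigr => M _.
    (* Only sets in the support of [nu] are known to be matchings; the others have weight 0. *)
    have [->|/nu_matching mM] := eqVneq (nu M) 0.
      rewrite !mul0r big1 ?mulr0 ?subrr // => u _.
      by rewrite big1 // => v _; rewrite !mul0r.
    rewrite (match_mx_sqnorm _ _ _ _ graphE mM).
    have := dirichlet_form _ _ _ y (match_mx_sym R n M) (match_mx_row_sum R n _ M graphE mM).
    rewrite -/N => h.
    rewrite (_ : (y *m _ *m _) 0 0 = N - 2^-1 *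
      \sum_u \sum_v match_mx R M u v * (y 0 u - y 0 v) ^+ 2); last by rewrite -h subKr.
    rewrite mulrBr mulrCA; congr (_ - _ * _).
    rewrite mulr_sumr; apply: eq_bigr => u _; rewrite mulr_sumr.
    by apply: eq_bigr => v _; rewrite mulrA.
  rewrite sumrB -mulr_suml nu_sum mul1r -mulr_sumr; congr (_ - _ * _).
  rewrite exchange_big; apply: eq_bigr => u _; rewrite exchange_big.
  by apply: eq_bigr => v _; rewrite mulr_suml.
have [_ /(_ y sum_y)] := spectral_gap R n d e s n1 graphE conn reg char_s.
rewrite Pmx_dirichlet // -/N => gap.
have dp_ge0 : 0 <= d%:R * p by rewrite mulr_ge0.
rewrite mulrBl mul1r lerD2l lerN2 -(mulrA (d%:R * p)).
apply: le_trans (ler_wpM2l dp_ge0 gap) _.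
rewrite mulrCA ler_pM2l ?invr_gt0 ?ltr0n // mulr_sumr ler_sum // => u _.
rewrite mulr_sumr ler_sum // => v _.
have [->|uv] := eqVneq u v; first by rewrite subrr expr0n !mulr0.
rewrite mulrA; apply: ler_wpM2r; first exact: sqr_ge0.
by rewrite (mulrC d%:R); apply: expected_match_entry.
Qed.

End OneRound.

(** * Independent rounds and iterated contraction *)

Section FirstRound.

Variables (T : finType) (t : nat).

Definition ffun_cons (x : T) (f : {ffun 'I_t -> T}) : {ffun 'I_t.+1 -> T} :=
  [ffun i => if unlift ord0 i is Some j then f j else x].

Lemma ffun_cons0 (x : T) (f : {ffun 'I_t -> T}) : ffun_cons x f ord0 = x.
Proof. by rewrite ffunE unlift_none. Qed.

Lemma ffun_consS (x : T) (f : {ffun 'I_t -> T}) (i : 'I_t) :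
  ffun_cons x f (lift ord0 i) = f i.
Proof. by rewrite ffunE liftK. Qed.

(** Splits a sum over trajectories by the outcome of the first round. *)
Lemma sum_ffun_cons (V : nmodType) (F : {ffun 'I_t.+1 -> T} -> V) :
  \sum_f F f = \sum_x \sum_g F (ffun_cons x g).
Proof.
rewrite pair_big /= (reindex (fun xg => ffun_cons xg.1 xg.2)) //=.
exists (fun f : {ffun 'I_t.+1 -> T} => (f ord0, [ffun j => f (lift ord0 j)])).
  move=> [x g] _ /=; rewrite ffun_cons0; congr (_, _).
  by apply/ffunP => j; rewrite ffunE ffun_consS.
move=> f _ /=; apply/ffunP => i; rewrite ffunE.
by case: unliftP => [j|] -> //; rewrite ffunE.
Qed.

End FirstRound.

Lemma proc_mx_cons (R : realType) (n t : nat) (M : {set {set 'I_n}})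
    (ms : {ffun 'I_t -> {set {set 'I_n}}}) :
  proc_mx R (ffun_cons _ _ M ms) = match_mx R M *m proc_mx R ms.
Proof.
rewrite /proc_mx enum_ordSl /= ffun_cons0 -map_comp; congr (_ *m foldr _ _ _).
by apply: eq_map => i /=; rewrite ffun_consS.
Qed.

Lemma proc_mx_const (R : realType) (n t : nat) (e : rel 'I_n)
    (ms : {ffun 'I_t -> {set {set 'I_n}}}) :
  simple_graph e -> (forall i, is_matching e (ms i)) ->
  const_mx 1 *m proc_mx R ms = const_mx 1 :> 'rV_n.
Proof.
move=> graphE msM; rewrite /proc_mx.
elim: (enum 'I_t) => [|i l IH] /=; first by rewrite mulmx1.
rewrite mulmxA (_ : const_mx 1 *m _ = const_mx 1) //.
apply/rowP => u; rewrite (mul_match_mx _ _ _ _ graphE (msM i)) !mxE.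
by field.
Qed.

Lemma sum_trajectory_prob (R : realType) (n t : nat) (e : rel 'I_n)
    (mu : nat -> {ffun {set {set 'I_n}} -> R}) :
  random_matching_model e mu ->
  \sum_(ms : {ffun 'I_t -> {set {set 'I_n}}}) \prod_(i < t) mu i.+1 (ms i) = 1.
Proof.
move=> model.
rewrite -(bigA_distr_bigA (fun (i : 'I_t) M => mu i.+1 M)) /= big1 // => i _.
by case: (model i.+1).
Qed.

Lemma trajectory_prob_ge0 (R : realType) (n t : nat) (e : rel 'I_n)
    (mu : nat -> {ffun {set {set 'I_n}} -> R}) (ms : {ffun 'I_t -> {set {set 'I_n}}}) :
  random_matching_model e mu -> 0 <= \prod_(i < t) mu i.+1 (ms i).
Proof. by move=> model; rewrite prodr_ge0 // => i _; case: (model i.+1). Qed.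

Section Trajectory.

Variables (R : realType) (n d : nat) (e : rel 'I_n) (s : seq R) (p : R).
Hypotheses (n1 : (1 < n)%N) (graphE : simple_graph e).
Hypotheses (conn : graph_connected e) (reg : regular e d).
Hypothesis char_s : char_poly (Pmx R e d) = \prod_(x <- s) ('X - x%:P).
Hypothesis p_gt0 : 0 < p.

Notation mtype := {set {set 'I_n}}.
Notation gamma := (d%:R * p * (1 - lambda2 s)).

(** Induction peels off the first round; [mu] is general because the later rounds follow the shifted
    model. The rate is [expR (- gamma)], not [1 - gamma], so that its powers are nonnegative
    whatever the size of [gamma]. *)
Lemma expected_sqnorm (t : nat) (mu : nat -> {ffun mtype -> R}) (y : 'rV[R]_n) :
  random_matching_model e mu -> pmin_lower_bound e mu p -> \sum_i y 0 i = 0 ->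
  \sum_(ms : {ffun 'I_t -> mtype}) \prod_(i < t) mu i.+1 (ms i) *
    ((y *m proc_mx R ms) *m (y *m proc_mx R ms)^T) 0 0
  <= expR (- gamma) ^+ t * (y *m y^T) 0 0.
Proof.
elim: t mu y => [|t IH] mu y model pmin sum_y.
  have card1 : #|{ffun 'I_0 -> mtype}| = 1%N by rewrite card_ffun card_ord expn0.
  rewrite (eq_bigr (fun=> (y *m y^T) 0 0)) => [|ms _]; last first.
    by rewrite big_ord0 mul1r /proc_mx enum_ord0 mulmx1.
  by rewrite sumr_const card1 expr0 mul1r.
have [mu_ge0 mu_sum mu_matching] := model 1%N isT.
have model' : random_matching_model e (fun i => mu i.+1) by move=> i _; apply: model.
have pmin' : pmin_lower_bound e (fun i => mu i.+1) p by move=> i _; apply: pmin.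
rewrite sum_ffun_cons.
apply: (@le_trans _ _ (\sum_(M : mtype) expR (- gamma) ^+ t *
   (mu 1%N M * ((y *m match_mx R M) *m (y *m match_mx R M)^T) 0 0))).
  apply: ler_sum => M _.
  under eq_bigr => ms _.
    rewrite big_ord_recl ffun_cons0 proc_mx_cons mulmxA -mulrA.
    under eq_bigr => i _ do rewrite ffun_consS.
    over.
  rewrite -mulr_sumr mulrCA.
  have [->|muN0] := eqVneq (mu 1%N M) 0; first by rewrite !mul0r.
  apply: ler_wpM2l => //; apply: (IH (fun i => mu i.+1)) => //.
  by rewrite (match_mx_sum _ _ _ _ graphE (mu_matching _ muN0)).
rewrite -mulr_sumr exprSr -(mulrA (_ ^+ t)); apply: ler_wpM2l.
  by rewrite exprn_ge0 ?expR_ge0.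
have contr := round_contraction _ _ d e s _ p n1 graphE conn reg char_s
  mu_ge0 mu_sum mu_matching (ltW p_gt0) (pmin 1%N isT) _ sum_y.
apply: le_trans contr _.
by apply: ler_wpM2r; [exact: sqnorm_ge0|exact: expR_ge1Dx].
Qed.

End Trajectory.

(** * Smoothing criterion through centred basis vectors *)

Definition centered_basis (R : realType) (n : nat) (u : 'I_n) : 'rV[R]_n :=
  \row_j ((j == u)%:R - n%:R^-1).

Lemma sum_indicator (R : realType) (n : nat) (u : 'I_n) (f : 'I_n -> R) :
  \sum_j (j == u)%:R * f j = f u.
Proof.
rewrite (bigD1 u) //= eqxx mul1r big1 ?addr0 // => j /negbTE ->.
by rewrite mul0r.
Qed.

Lemma sum_centered_basis (R : realType) (n : nat) (u : 'I_n) :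
  (0 < n)%N -> \sum_j centered_basis R n u 0 j = 0.
Proof.
move=> n0; under eq_bigr do rewrite mxE -[_%:R]mulr1.
rewrite sumrB sum_indicator sumr_const card_ord -[_ *+ n]mulr_natr mulVf ?subrr //.
by rewrite pnatr_eq0 -lt0n.
Qed.

Lemma centered_basis_sqnorm (R : realType) (n : nat) (u : 'I_n) : (0 < n)%N ->
  (centered_basis R n u *m (centered_basis R n u)^T) 0 0 = 1 - n%:R^-1.
Proof.
move=> n0; have nN0 : n%:R != 0 :> R by rewrite pnatr_eq0 -lt0n.
rewrite sqnormE.
rewrite (eq_bigr (fun j => (j == u)%:R * (1 - n%:R^-1 - n%:R^-1) + n%:R^-1 ^+ 2)).
  rewrite big_split /= sum_indicator sumr_const card_ord -[_ *+ n]mulr_natr.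
  by field.
by move=> j _; rewrite mxE; case: (j == u) => /=; ring.
Qed.

(** Up to a constant vector, which [A] fixes, any load is a combination of the [n] centred basis
    vectors with coefficients at most [K] in absolute value. One condition on [A] thus serves all
    initial loads. *)
Lemma smoothing_of_sqnorm (R : realType) (n : nat) (A : 'M[R]_n) (K eps : R) :
  const_mx 1 *m A = const_mx 1 :> 'rV_n -> 0 <= K -> 0 <= eps ->
  (2 * n%:R * K) ^+ 2 *
    (\sum_u ((centered_basis R n u *m A) *m (centered_basis R n u *m A)^T) 0 0)
  <= eps ^+ 2 ->
  smoothing A K eps.
Proof.
move=> A1 K0 eps0; set F := \sum_u _ => leF x xK.
have F0 : 0 <= F by rewrite sumr_ge0 // => u _; apply: sqnorm_ge0.
pose f := Num.sqrt F.
have f0 : 0 <= f by apply: sqrtr_ge0.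
have fle u v : `|(centered_basis R n u *m A) 0 v| <= f.
  rewrite -sqrtr_sqr ler_wsqrtr // /F (bigD1 u) //= sqnormE (bigD1 v) //= -addrA.
  rewrite lerDl addr_ge0 ?sumr_ge0 // => [w _|w _]; first exact: sqr_ge0.
  exact: sqnorm_ge0.
have eps_f : n%:R * (K * (2 * f)) <= eps.
  rewrite -(ler_pXn2r (n := 2)) // ?nnegrE ?mulr_ge0 //.
  apply: le_trans leF; rewrite le_eqVlt; apply/orP; left; apply/eqP.
  by rewrite -[F in RHS]sqr_sqrtr // -/f; ring.
apply: bigmax_le => // v _; apply: bigmax_le => // w _.
(* Measuring loads relative to node [v] bounds all coefficients by the discrepancy. *)
pose c := x 0 v.
have xc u : `|x 0 u - c| <= K.
  apply: le_trans xK; rewrite /disc.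
  apply: le_trans (le_bigmax _ _ u).
  exact: (le_bigmax _ (fun v => `|x 0 u - x 0 v|) v).
(* Adds back the reference load and the mean that centring removes; it cancels in differences of
   final loads. *)
pose k := c + n%:R^-1 * \sum_u (x 0 u - c).
have xE : x = \sum_u (x 0 u - c) *: centered_basis R n u + k *: const_mx 1.
  apply/rowP => j; rewrite !mxE summxE mulr1.
  rewrite (eq_bigr (fun u => (u == j)%:R * (x 0 u - c) - (x 0 u - c) * n%:R^-1)).
    by rewrite sumrB sum_indicator -mulr_suml /k; ring.
  by move=> u _; rewrite !mxE (eq_sym j); ring.
have xAE j : (x *m A) 0 j =
    \sum_u (x 0 u - c) * (centered_basis R n u *m A) 0 j + k.
  rewrite {1}xE mulmxDl mulmx_suml -scalemxAl A1 !mxE summxE mulr1.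
  by congr (_ + _); apply: eq_bigr => u _; rewrite -scalemxAl mxE.
rewrite !xAE opprD addrACA subrr addr0 -sumrB.
apply: le_trans (ler_norm_sum _ _ _) _; apply: le_trans eps_f.
rewrite -[n in n%:R]card_ord mulr_natl -sumr_const; apply: ler_sum => u _.
rewrite -mulrBr normrM; apply: ler_pM => //.
by rewrite mulr_natl mulr2n (le_trans (ler_normB _ _)) // lerD.
Qed.

(** * Probability bound and choice of the time *)

(** Markov's inequality for [F], the total squared norm of the images of the centred basis: whenever
    [k * F ms] is below 1, the trajectory is smoothing. *)
Lemma prob_smoothing_lower_bound (R : realType) (n d : nat) (e : rel 'I_n)
    (mu : nat -> {ffun {set {set 'I_n}} -> R}) (p K eps : R) (s : seq R) (t : nat) :
  (1 < n)%N ->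
  simple_graph e -> graph_connected e -> regular e d ->
  random_matching_model e mu ->
  pmin_lower_bound e mu p -> 0 < p ->
  char_poly (Pmx R e d) = \prod_(x <- s) ('X - x%:P) ->
  0 < eps -> 0 <= K ->
  1 - (2 * n%:R * K / eps) ^+ 2 * n%:R * expR (- (d%:R * p * (1 - lambda2 s))) ^+ t
  <= prob_smoothing mu t K eps.
Proof.
move=> n1 graphE conn reg model pmin p0 char_s eps0 K0.
set c := expR _; set k := (_ / eps) ^+ 2.
pose F (ms : {ffun 'I_t -> {set {set 'I_n}}}) :=
  \sum_u ((centered_basis R n u *m proc_mx R ms) *m
          (centered_basis R n u *m proc_mx R ms)^T) 0 0.
have F0 ms : 0 <= F ms by rewrite sumr_ge0 // => u _; apply: sqnorm_ge0.
have k0 : 0 <= k by apply: sqr_ge0.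
have EF : \sum_(ms : {ffun 'I_t -> {set {set 'I_n}}})
    (\prod_(i < t) mu i.+1 (ms i)) * F ms <= n%:R * c ^+ t.
  under eq_bigr do rewrite mulr_sumr.
  rewrite exchange_big /= -[n in n%:R]card_ord mulr_natl -sumr_const.
  apply: ler_sum => u _.
  apply: le_trans (expected_sqnorm _ _ d e s p n1 graphE conn reg char_s p0
    t mu _ model pmin (sum_centered_basis _ _ u (ltnW n1))) _.
  rewrite centered_basis_sqnorm ?(ltnW n1) // -[leRHS]mulr1.
  by apply: ler_wpM2l; rewrite ?exprn_ge0 ?expR_ge0 // gerBl invr_ge0.
apply: (@le_trans _ _ (1 - k * (\sum_(ms : {ffun 'I_t -> {set {set 'I_n}}})
    (\prod_(i < t) mu i.+1 (ms i)) * F ms))).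
  by rewrite lerD2l lerN2 -mulrA; apply: ler_wpM2l.
rewrite -[X in X - _](sum_trajectory_prob R n t e mu model) mulr_sumr -sumrB.
(* Markov's inequality trajectory by trajectory: [1 - k * F ms] is at most the indicator of
   smoothing. *)
apply: ler_sum => ms _; set q := \prod_i _.
have q0 : 0 <= q by apply: trajectory_prob_ge0 model.
have [->|qN0] := eqVneq q 0; first by rewrite !mul0r mulr0 subrr.
rewrite mulrCA -{1}[q]mulr1 -mulrBr; apply: ler_wpM2l => //.
case: ifPn => [_|/asboolPn nsm]; first by rewrite gerBl mulr_ge0.
rewrite subr_le0 leNgt; apply/negP => kF; apply: nsm.
apply: smoothing_of_sqnorm => //; last 1 first.
- have : (k * F ms) * eps ^+ 2 <= 1 * eps ^+ 2.
    by apply: ler_wpM2r; [exact: sqr_ge0|exact: ltW].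
  rewrite mul1r /k exprMn exprVn mulrAC -(mulrA (_ ^+ 2)) mulVf ?mulr1 //.
  by rewrite expf_neq0 // gt_eqF.
- apply: proc_mx_const graphE _ => i.
  have [_ _] := model i.+1 isT; apply.
  by move: qN0; rewrite /q => /prodf_neq0; apply.
- exact: ltW.
Qed.

(** An expected squared norm is nonnegative, so the contraction factor applied to a nonzero centred
    basis vector cannot be negative. *)
Lemma contraction_rate_le1 (R : realType) (n d : nat) (e : rel 'I_n)
    (mu : nat -> {ffun {set {set 'I_n}} -> R}) (p : R) (s : seq R) :
  (1 < n)%N ->
  simple_graph e -> graph_connected e -> regular e d ->
  random_matching_model e mu -> pmin_lower_bound e mu p -> 0 <= p ->
  char_poly (Pmx R e d) = \prod_(x <- s) ('X - x%:P) ->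
  d%:R * p * (1 - lambda2 s) <= 1.
Proof.
move=> n1 graphE conn reg model pmin p0 char_s.
have n0 := ltnW n1; pose u : 'I_n := Ordinal n0.
have [mu_ge0 mu_sum mu_matching] := model 1%N isT.
have := round_contraction _ _ d e s _ p n1 graphE conn reg char_s
  mu_ge0 mu_sum mu_matching p0 (pmin 1%N isT) _ (sum_centered_basis _ _ u n0).
rewrite centered_basis_sqnorm // => h.
have : 0 <= (1 - d%:R * p * (1 - lambda2 s)) * (1 - n%:R^-1).
  by apply: le_trans h; rewrite sumr_ge0 // => M _; rewrite mulr_ge0 ?sqnorm_ge0.
rewrite pmulr_lge0; first by rewrite subr_ge0.
by rewrite subr_gt0 invf_lt1 ?ltr1n ?ltr0n.
Qed.

Theorem theorem2p5 (R : realType) (n d : nat) (e : rel 'I_n)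
    (mu : nat -> {ffun {set {set 'I_n}} -> R}) (p K eps : R) (s : seq R) :
  (1 < n)%N ->
  simple_graph e -> graph_connected e -> regular e d ->
  random_matching_model e mu ->
  pmin_lower_bound e mu p -> 0 < p ->
  char_poly (Pmx R e d) = \prod_(x <- s) ('X - x%:P) ->
  0 < eps -> eps <= K ->
  exists t : nat, is_tau_cont mu K eps t /\
    t%:R <= 8 / (d%:R * p) * (1 - lambda2 s)^-1
              * ln (K * n%:R ^+ 2 / (eps / 2)).
Proof.
move=> n1 graphE conn reg model pmin p0 char_s eps0 epsK.
have K0 : 0 < K by apply: lt_le_trans epsK.
have d0 : 0 < d%:R :> R.
  by rewrite ltr0n (connected_regular_degree_gt0 _ _ _ n1 conn reg).
have [gap0 _] := spectral_gap R n d e s n1 graphE conn reg char_s.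
pose g := d%:R * p * (1 - lambda2 s).
have g0 : 0 < g by rewrite !mulr_gt0.
have g1 : g <= 1 by apply: contraction_rate_le1 (ltW p0) char_s; eassumption.
set X := K * _ / _; set L := ln X.
have n0 : 0 < n%:R :> R by rewrite ltr0n ltnW.
(* Uses [n >= 2] and [eps <= K]. *)
have X8 : 8 <= X.
  rewrite /X ler_pdivlMr ?divr_gt0 // (_ : 8 * (eps / 2) = eps * 2 ^+ 2); last by field.
  by apply: ler_pM; rewrite ?exprn_ge0 ?(ltW eps0) // lerXn2r ?nnegrE ?ler_nat // ltW.
have X0 : 0 < X by lra.
have expL : expR L = X by rewrite lnK.
(* From [1 - L <= expR (- L) = X^-1 <= 1/8]. *)
have L1 : 1 <= 8 * L.
  have := expR_ge1Dx (- L); rewrite expRN expL.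
  have : X^-1 <= 8^-1 by rewrite lef_pV2 ?posrE.
  lra.
set B := _ * L.
have gB : g * B = 8 * L.
  by rewrite /B /g; field; rewrite !gt_eqF.
have B1 : 1 <= B by nra.
pose T := Num.truncn B.
have /andP[TB BT] := truncn_itv (le_trans ler01 B1).
have T1 : 1 <= T%:R :> R by rewrite ler1n truncn_gt0.
(* Since [B < T + 1 <= 2 * T], in fact [g * T] is at least [g * B / 2 = 4 * L]. *)
have gT : 2 * L <= g * T%:R.
  have : B <= 2 * T%:R by move: BT; rewrite -natr1 -/T; lra.
  by nra.
have probT : 1 - n%:R^-1 <= prob_smoothing mu T K eps.
  apply: le_trans (prob_smoothing_lower_bound R n d e mu p K eps s T n1 graphE
    conn reg model pmin p0 char_s eps0 (ltW K0)).
  rewrite lerD2l lerN2 -expRM_natr mulNr -/g.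
  (* The time gives decay [X ^- 2]. As [X] is [n] times [2 * n * K / eps], the failure bound becomes
     exactly [n^-1]. *)
  apply: (@le_trans _ _ ((2 * n%:R * K / eps) ^+ 2 * n%:R * (X ^+ 2)^-1)).
    apply: ler_wpM2l; first by rewrite mulr_ge0 ?sqr_ge0 ?ltW.
    by rewrite -expL -expRM_natl -expRN ler_expR lerN2.
  rewrite le_eqVlt; apply/orP; left; apply/eqP.
  by rewrite /X; field; rewrite !gt_eqF.
have exT : exists t, 1 - n%:R^-1 <= prob_smoothing mu t K eps by exists T.
(* The least good time exists because [T] is good, and it is at most [T <= B]. *)
exists (ex_minn exT); case: ex_minnP => t probt tmin; split; last first.
  by apply: le_trans TB; rewrite ler_nat tmin.
split=> // t' t't; rewrite ltNge; apply/negP => /tmin.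
by rewrite leqNgt t't.
Qed.
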